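(* Let $G$ be a locally finite connected graph with base vertex $e$, and let $P=(p(v,w))_{v,w\in G}$ be the transition matrix of a transient, uniformly irreducible random walk $(Z_n)_{n\ge 0}$ on $G$ with bounded range. Then there exists a Floyd function $f$ such that, for any starting point $Z_0=v\in G$, the sequence $Z_n$ converges almost surely (in the Floyd compactification $\bar G$ associated with $f$) to a point of the Floyd boundary $\partial_f G$.
   Context: $G$ also denotes the vertex set; $v\sim w$ means $v,w$ are adjacent; $d$ is the graph distance; $e\in G$ is a fixed vertex and $|v|=d(e,v)$. Floyd function: a function $f:\{0,1,2,\dots\}\to(0,\infty)$ such that there is a constant $\lambda>0$ with $\lambda f(r)\le f(r+1)\le f(r)$ for every integer $r>0$, and $\sum_{r=0}^\infty f(r)<\infty$. Floyd boundary: an edge $[v,w]$ gets length $f(|[v,w]|)$, where $|[v,w]|=\min\{|v|,|w|\}$. A path $\alpha=(x_1,\dots,x_n)$ (consecutive vertices adjacent) has Floyd length $L_f(\alpha)=\sum_{i=1}^{n-1} f(|[x_i,x_{i+1}]|)$, and $d_f(v,w)=\inf_\alpha L_f(\alpha)$ over all paths $\alpha$ connecting $v$ and $w$. $\bar G$ is the metric completion of $(G,d_f)$ (the Floyd compactification), and $\partial_f G=\bar G\setminus G$ is the Floyd boundary. Random walk: $p^{(n)}(v,w)$ are the entries of $P^n$. Uniformly irreducible: there are $c_0>0$ and $K>0$ such that for all $v\sim w$ there is an integer $\kappa<K$ with $p^{(\kappa)}(v,w)\ge c_0$. Bounded range: there is $M>0$ with $\sup\{d(v,w): v,w\in G,\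 p(v,w)>0\}\le M$. Green function: $g(v,w)=\sum_{n\ge0}p^{(n)}(v,w)$, the expected number of visits to $w$ when $Z_0=v$. Transient: $g(v,w)<\infty$ for all $v,w\in G$. *)

(* Defs.v *)
From HB Require Import structures.
From mathcomp Require Import all_boot all_order all_algebra.
From mathcomp Require Import all_classical all_reals all_analysis.

Set Implicit Arguments.
Unset Strict Implicit.
Unset Printing Implicit Defensive.

Import Order.TTheory GRing.Theory Num.Theory.
Import numFieldNormedType.Exports.
Import metricType_numDomainType.

Local Open Scope classical_set_scope.
Local Open Scope ring_scope.
Local Open Scope quotient_scope.

(* The completion of a metric space T: Cauchy sequences in T modulo
   lim d(x_n, y_n) = 0, with the distance lim d(x_n, y_n). *)
Section Completion.
Context {R : realType} (T : metricType R).

Record cauchy_seq := CauchySeq {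
  cseq :> nat -> T;
  cseqP : cauchy (cseq @ \oo)
}.

HB.instance Definition _ := gen_eqMixin cauchy_seq.
HB.instance Definition _ := gen_choiceMixin cauchy_seq.

Definition cdist (x y : cauchy_seq) : R := limn (fun n => mdist (x n) (y n)).

Lemma cauchy_seq_lt (x : cauchy_seq) (eps : R) : 0 < eps ->
  exists N, forall m n, (N <= m)%N -> (N <= n)%N -> mdist (x m) (x n) < eps.
Proof.
move=> eps0.
have /cauchy_ballP/(_ _ eps0)[[/= A B] [[N1 _ AN] [N2 _ BN]] AB] := cseqP x.
exists (maxn N1 N2) => m n; rewrite !geq_max => /andP[m1 m2] /andP[n1 n2].
by have := AB (x m, x n) (conj (AN _ m1) (BN _ n2)); rewrite /= ballEmdist.
Qed.

Lemma lt_cauchy_seq (x : nat -> T) :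
  (forall eps : R, 0 < eps -> exists N, forall m n, (N <= m)%N -> (N <= n)%N ->
     mdist (x m) (x n) < eps) ->
  cauchy (x @ \oo).
Proof.
move=> h; apply/cauchy_ballP => eps /h[N xN].
exists (x @` [set n | (N <= n)%N], x @` [set n | (N <= n)%N]) => /=.
  by split; exists N => // n Nn; exists n.
by move=> [_ _] [/= [m Nm <-] [n Nn <-]]; rewrite ballEmdist; exact: xN.
Qed.

Lemma mdist_le_quad (a b c d : T) :
  `|mdist a b - mdist c d| <= mdist a c + mdist b d.
Proof.
have h (u v w z : T) : mdist u v - mdist w z <= mdist u w + mdist v z.
  rewrite lerBlDr (le_trans (metric_triangle u w v))// -addrA lerD2l.
  by rewrite (le_trans (metric_triangle w z v))// addrC (metric_sym z) lexx.
rewrite ler_norml h andbT lerNl opprB (le_trans (h _ _ _ _))//.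
by rewrite (metric_sym c) (metric_sym d).
Qed.

Lemma cdist_is_cvg (x y : cauchy_seq) : cvgn (fun n => mdist (x n) (y n)).
Proof.
apply: R_complete; apply/cauchy_ballP => eps eps0.
have e20 : 0 < eps / 2 by rewrite divr_gt0.
have [N1 h1] := cauchy_seq_lt x e20; have [N2 h2] := cauchy_seq_lt y e20.
pose A := (fun n => mdist (x n) (y n)) @` [set n | (maxn N1 N2 <= n)%N].
exists (A, A) => /=; first by split; exists (maxn N1 N2) => // n Nn; exists n.
move=> [_ _] [/= [m + <-] [n + <-]]; rewrite /= !geq_max.
move=> /andP[m1 m2] /andP[n1 n2]; rewrite /ball/=.
rewrite (le_lt_trans (mdist_le_quad _ _ _ _))// [ltRHS]splitr ltrD//.
- exact: h1.
- exact: h2.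
Qed.

Lemma cdistxx x : cdist x x = 0.
Proof.
rewrite /cdist; under eq_fun do rewrite mdistxx.
exact: lim_cst.
Qed.

Lemma cdist_sym x y : cdist x y = cdist y x.
Proof. by rewrite /cdist; under eq_fun do rewrite metric_sym. Qed.

Lemma cdist_triangle y x z : cdist x z <= cdist x y + cdist y z.
Proof.
rewrite /cdist -limD; [|exact: cdist_is_cvg..].
apply: ler_lim; [exact: cdist_is_cvg|apply: is_cvgD; exact: cdist_is_cvg|].
by near=> n; exact: metric_triangle.
Unshelve. all: by end_near. Qed.

Lemma cdist_ge0 x y : 0 <= cdist x y.
Proof.
rewrite -(@pmulrn_lge0 _ _ 2)// -(cdistxx x).
by rewrite (le_trans (cdist_triangle y _ _))// cdist_sym -mulr2n.
Qed.

Lemma cdist_le (x y : cauchy_seq) e :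
  (\forall n \near \oo, mdist (x n) (y n) <= e) -> cdist x y <= e.
Proof. by move=> xye; apply: limr_le => //; exact: cdist_is_cvg. Qed.

Definition cequiv : rel cauchy_seq := fun x y => cdist x y == 0.

Lemma cequiv_refl : reflexive cequiv.
Proof. by move=> x; rewrite /cequiv cdistxx. Qed.

Lemma cequiv_sym : symmetric cequiv.
Proof. by move=> x y; rewrite /cequiv cdist_sym. Qed.

Lemma cequiv_trans : transitive cequiv.
Proof.
move=> y x z /eqP xy /eqP yz; rewrite /cequiv eq_le cdist_ge0 andbT.
by rewrite (le_trans (cdist_triangle y _ _))// xy yz addr0.
Qed.

Canonical cequiv_equiv := EquivRel cequiv cequiv_refl cequiv_sym cequiv_trans.

Definition completion : Type := {eq_quot cequiv}.

HB.instance Definition _ := Quotient.on completion.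
HB.instance Definition _ := EqQuotient.on completion.
HB.instance Definition _ := Choice.on completion.

Definition completion_dist (a b : completion) : R := cdist (repr a) (repr b).

Lemma cdist_equiv x x' y y' :
  cequiv x x' -> cequiv y y' -> cdist x y = cdist x' y'.
Proof.
move=> /eqP xx' /eqP yy'; apply/eqP; rewrite eq_le; apply/andP; split.
- rewrite (le_trans (cdist_triangle x' _ _))// xx' add0r.
  by rewrite (le_trans (cdist_triangle y' _ _))// (cdist_sym y') yy' addr0.
- rewrite (le_trans (cdist_triangle x _ _))// (cdist_sym x') xx' add0r.
  by rewrite (le_trans (cdist_triangle y _ _))// yy' addr0.
Qed.

Lemma completion_dist_pi x y :
  completion_dist (\pi_completion x) (\pi_completion y) = cdist x y.
Proof.
by apply: cdist_equiv; rewrite -eqmodE reprK.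
Qed.

Let completion_distxx a : completion_dist a a = 0.
Proof. exact: cdistxx. Qed.

Let completion_dist_positivity a b : completion_dist a b = 0 -> a = b.
Proof.
by move=> /eqP ab; rewrite -[a]reprK -[b]reprK; apply/eqquotP.
Qed.

Let completion_dist_sym a b : completion_dist a b = completion_dist b a.
Proof. exact: cdist_sym. Qed.

Let completion_dist_triangle b a c :
  completion_dist a c <= completion_dist a b + completion_dist b c.
Proof. exact: cdist_triangle. Qed.

HB.instance Definition _ := @isMetric.Build R completion completion_dist
  completion_distxx completion_dist_positivity completion_dist_sym
  completion_dist_triangle.

Lemma cauchy_cst (x : T) : cauchy ((fun _ : nat => x) @ \oo).
Proof. by apply: lt_cauchy_seq => e e0; exists 0%N => *; rewrite mdistxx. Qed.

Definition to_completion (x : T) : completion :=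
  \pi_completion (CauchySeq (cauchy_cst x)).

Lemma mdist_to_completion x y :
  mdist (to_completion x) (to_completion y) = mdist x y.
Proof. by rewrite [LHS]completion_dist_pi /cdist/=; exact: lim_cst. Qed.

Lemma cvg_to_completion (x : cauchy_seq) :
  (fun n => to_completion (x n)) @ \oo --> (\pi_completion x).
Proof.
apply/cvgrPdist_le => e e0; have [N xN] := cauchy_seq_lt x e0.
near=> n; rewrite [X in X <= _]completion_dist_pi; apply: cdist_le.
near=> m; apply/ltW/xN; first by near: m; exists N.
by near: n; exists N.
Unshelve. all: by end_near. Qed.

Lemma dense_to_completion : dense (range to_completion).
Proof.
move=> U [a Ua] oU; rewrite -[a]reprK in Ua.
have /cvg_to_completion[N _ UN] : nbhs (\pi_completion (repr a)) U.
  exact: open_nbhs_nbhs.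
by exists (to_completion (repr a N)); split; [exact: (UN _ (leqnn N))|exists (repr a N)].
Qed.

Lemma completion_complete (F : set_system completion) :
  ProperFilter F -> cauchy F -> exists a : completion, F --> a.
Proof.
move=> FF /cauchyP Fc.
have h n : {a : completion | F (ball a n.+1%:R^-1)}.
  by apply: cid; apply: Fc; rewrite invr_gt0.
pose a n := sval (h n).
have g n : {t : T | mdist (a n) (to_completion t) < n.+1%:R^-1}.
  apply: cid; have /cvgrPdist_lt h0 := @cvg_to_completion (repr (a n)).
  have n0 : (0 : R) < n.+1%:R^-1 by rewrite invr_gt0.
  have [N _ /(_ _ (leqnn N))] := h0 _ n0; rewrite /= reprK => ?.
  by exists (repr (a n) N).
pose t n := sval (g n).
have Ft n : F [set b | mdist (to_completion (t n)) b < 2 / n.+1%:R].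
  have := svalP (h n); apply: filterS => b; rewrite ballEmdist/= => ab.
  rewrite (le_lt_trans (metric_triangle _ (a n) _))// mulr_natl mulr2n ltrD//.
  by rewrite metric_sym; exact: (svalP (g n)).
have small (e : R) : 0 < e -> exists N, forall n, (N <= n)%N -> 2 / n.+1%:R < e.
  move=> e0; exists (Num.trunc (2 / e)) => n Nn.
  rewrite ltr_pdivrMr// -ltr_pdivrMl// mulrC.
  rewrite (lt_le_trans (truncnS_gt _))//.
  by rewrite ler_nat ltnS.
have ct : cauchy (t @ \oo).
  apply: lt_cauchy_seq => e e0; have e20 : 0 < e / 2 by rewrite divr_gt0.
  have [N hN] := small _ e20.
  exists N => m n Nm Nn; have [b [/= mb nb]] := filter_ex (filterI (Ft m) (Ft n)).
  rewrite -mdist_to_completion (le_lt_trans (metric_triangle _ b _))//.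
  rewrite [ltRHS]splitr ltrD ?(lt_trans mb) ?hN//.
  by rewrite metric_sym (lt_trans nb)// hN.
exists (\pi_completion (CauchySeq ct)); apply/fcvgrPdist_lt => e e0.
have e20 : 0 < e / 2 by rewrite divr_gt0.
have [N1 hN] := small _ e20.
have /cvgrPdist_lt/(_ _ e20)[N2 _ tN] := @cvg_to_completion (CauchySeq ct).
apply: filterS (Ft (maxn N1 N2)) => b /= tb.
rewrite (le_lt_trans (metric_triangle _ (to_completion (t (maxn N1 N2))) _))//.
rewrite [ltRHS]splitr ltrD ?(lt_trans tb) ?hN ?leq_maxl//.
by apply: tN; rewrite /= leq_maxr.
Qed.

End Completion.

(* Loops are not excluded from adj: they change neither distances nor the
   random walk hypotheses. *)
Record lfcgraph := LfcGraph {
  vertex :> choiceType;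
  adj : rel vertex;
  adj_sym : symmetric adj;
  adj_finite : forall v, finite_set [set w | adj v w];
  adj_connected : forall v w, exists s, path adj v s /\ last v s = w
}.

Section GraphDistance.
Context {G : lfcgraph}.
Implicit Types v w : G.

Lemma walk_size_ex v w :
  exists n, `[< exists s, [/\ path (@adj G) v s, last v s = w & size s = n] >].
Proof.
by have [s [vs sw]] := adj_connected v w; exists (size s); apply/asboolP; exists s.
Qed.

Definition gdist v w : nat := ex_minn (walk_size_ex v w).

End GraphDistance.

Definition is_floyd_function (R : realType) (f : nat -> R) : Prop :=
  [/\ forall r, 0 < f r,
      exists2 lambda : R, 0 < lambda &
        forall r, (0 < r)%N -> lambda * f r <= f r.+1 <= f r
    & cvgn (series f)].

Record floydFunction (R : realType) := FloydFunction {
  floyd_fun :> nat -> R;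
  floyd_funP : is_floyd_function floyd_fun
}.

Section FloydDistance.
Context {R : realType} {G : lfcgraph} (e : G) (f : floydFunction R).
Implicit Types (v w : G) (s : seq G).

Definition edge_norm v w : nat := minn (gdist e v) (gdist e w).

(* The path is v :: s. *)
Definition floyd_length v s : R := \sum_(r <- pairmap edge_norm v s) f r.

Definition floyd_dist v w : R :=
  inf [set floyd_length v s | s in [set s | path (@adj G) v s /\ last v s = w]].

Lemma floyd_fun_gt0 r : 0 < f r.
Proof. by case: (floyd_funP f). Qed.

Lemma floyd_length_ge0 v s : 0 <= floyd_length v s.
Proof. by apply: sumr_ge0 => r _; rewrite ltW ?floyd_fun_gt0. Qed.

Lemma floyd_length_cat v s s' :
  floyd_length v (s ++ s') = floyd_length v s + floyd_length (last v s) s'.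
Proof. by rewrite /floyd_length pairmap_cat big_cat. Qed.

Lemma floyd_length_rev v s : path (@adj G) v s -> exists s',
  [/\ path (@adj G) (last v s) s', last (last v s) s' = v
    & floyd_length (last v s) s' = floyd_length v s].
Proof.
elim: s v => [|x s IH] v /=; first by exists [::].
move=> /andP[vx /IH[s' [ps' ls' fs']]]; exists (rcons s' v).
rewrite rcons_path ps' ls' adj_sym vx last_rcons; split=> //.
rewrite -cats1 floyd_length_cat fs' ls' /floyd_length/= !big_cons big_nil addr0.
by rewrite addrC /edge_norm minnC.
Qed.

Lemma floyd_dist_has_inf v w : has_inf
  [set floyd_length v s | s in [set s | path (@adj G) v s /\ last v s = w]].
Proof.
split; last by exists 0 => _ [s _ <-]; exact: floyd_length_ge0.
by have [s ?] := adj_connected v w; exists (floyd_length v s); exists s.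
Qed.

Lemma floyd_dist_le v s : path (@adj G) v s ->
  floyd_dist v (last v s) <= floyd_length v s.
Proof.
move=> vs; apply: ge_inf; last by exists s.
by case: (floyd_dist_has_inf v (last v s)).
Qed.

Lemma le_floyd_dist v w c :
  (forall s, path (@adj G) v s -> last v s = w -> c <= floyd_length v s) ->
  c <= floyd_dist v w.
Proof.
move=> h; apply: lb_le_inf; first by case: (floyd_dist_has_inf v w).
by move=> _ [s [vs sw] <-]; exact: h.
Qed.

Lemma floyd_dist_ge0 v w : 0 <= floyd_dist v w.
Proof. by apply: le_floyd_dist => s _ _; exact: floyd_length_ge0. Qed.

Lemma floyd_distxx v : floyd_dist v v = 0.
Proof.
apply/eqP; rewrite eq_le floyd_dist_ge0 andbT.
by rewrite (le_trans (@floyd_dist_le v [::] isT))// /floyd_length big_nil.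
Qed.

Lemma floyd_dist_sym v w : floyd_dist v w = floyd_dist w v.
Proof.
wlog suff h : v w / floyd_dist v w <= floyd_dist w v.
  by apply/eqP; rewrite eq_le !h.
apply: le_floyd_dist => s /floyd_length_rev[s' []] + + <- sv.
by rewrite sv => vs' <-; exact: floyd_dist_le.
Qed.

Lemma floyd_dist_triangle w v u :
  floyd_dist v u <= floyd_dist v w + floyd_dist w u.
Proof.
rewrite -lerBlDl; apply: le_floyd_dist => s ws su.
rewrite lerBlDl -lerBlDr; apply: le_floyd_dist => t vt tw.
rewrite lerBlDr -tw -floyd_length_cat -su -tw -last_cat.
by apply: floyd_dist_le; rewrite cat_path vt tw.
Qed.

Lemma floyd_dist_positivity v w : floyd_dist v w = 0 -> v = w.
Proof.
have [c c0 fc] : exists2 c : R, 0 < c &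
    forall r, (r <= gdist e v)%N -> c <= f r.
  elim: (gdist e v) => [|n [c c0 fc]].
    by exists (f 0%N) => [|[]//]; exact: floyd_fun_gt0.
  exists (Num.min c (f n.+1)); first by rewrite lt_min c0 floyd_fun_gt0.
  move=> r; rewrite leq_eqVlt ltnS ge_min => /predU1P[->|/fc ->//].
  by rewrite lexx orbT.
move=> vw0; apply/eqP/negPn/negP => vw.
suff : c <= floyd_dist v w by rewrite vw0 leNgt c0.
apply: le_floyd_dist => -[_ /= wv|x s _ _]; first by rewrite wv eqxx in vw.
rewrite /floyd_length/= big_cons (le_trans (fc _ (geq_minl _ (gdist e x))))//.
by rewrite lerDl; exact: floyd_length_ge0.
Qed.

(* The vertex set of G with the Floyd metric d_f. *)
Definition floyd_space : Type := G.

HB.instance Definition _ := Choice.on floyd_space.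
HB.instance Definition _ := @isMetric.Build R floyd_space floyd_dist
  floyd_distxx floyd_dist_positivity floyd_dist_sym floyd_dist_triangle.

Definition floyd_compactification : Type := completion floyd_space.
HB.instance Definition _ := Metric.on floyd_compactification.

Definition floyd_embed (v : G) : floyd_compactification :=
  to_completion (v : floyd_space).

Definition floyd_boundary : set floyd_compactification := 
  ~` range floyd_embed.

End FloydDistance.

Arguments floyd_boundary {R G} e f.

Section RandomWalk.
Context {R : realType} {G : lfcgraph}.
Implicit Types (p : G -> G -> R) (v w : G).
Local Open Scope ereal_scope.

Definition stochastic p : Prop :=
  (forall v w, (0 <= p v w)%R) /\
  (forall v, \esum_(w in [set: G]) (p v w)%:E = 1).

(* The entries p^(n)(v, w) of the n-th power of the matrix p. *)
Fixpoint mxpow p (n : nat) v w : \bar R :=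
  if n is m.+1 then \esum_(u in [set: G]) ((p v u)%:E * mxpow p m u w)
  else ((v == w)%:R)%:E.

Definition green p v w : \bar R := \sum_(0 <= n <oo) mxpow p n v w.

Definition transient p : Prop := forall v w, green p v w < +oo.

Definition uniformly_irreducible p : Prop :=
  exists c0 : R, exists K : nat, [/\ (0 < c0)%R, (0 < K)%N &
    forall v w, adj v w ->
      exists2 k : nat, (k < K)%N & c0%:E <= mxpow p k v w].

Definition bounded_range p : Prop :=
  exists2 M : nat, (0 < M)%N & forall v w, (0 < p v w)%R -> (gdist v w <= M)%N.

(* Z is a Markov chain with transition matrix p and Z 0 = v almost surely;
   the Markov property is written without conditioning, as
   P(Z_0 = x_0, ..., Z_(n+1) = x_(n+1))
     = P(Z_0 = x_0, ..., Z_n = x_n) p(x_n, x_(n+1)).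
   The vertex set is countable and carries the discrete sigma-algebra. *)
Definition random_walk p v (d : measure_display) (T : measurableType d)
    (P : probability T R) (Z : nat -> T -> G) : Prop :=
  [/\ forall n w, measurable (Z n @^-1` [set w]),
      P (Z 0%N @^-1` [set v]) = 1
    & forall n (x : nat -> G),
        P [set t | forall i, (i <= n.+1)%N -> Z i t = x i] =
        P [set t | forall i, (i <= n)%N -> Z i t = x i] * (p (x n) (x n.+1))%:E].

End RandomWalk.

(* Main.v *)
Require Import Defs.
From HB Require Import structures.
From mathcomp Require Import all_boot all_order all_algebra.
From mathcomp Require Import all_classical all_reals all_analysis.
From mathcomp Require Import measurable_realfun lra.

Set Implicit Arguments.
Unset Strict Implicit.
Unset Printing Implicit Defensive.

Import Order.TTheory GRing.Theory Num.Theory.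
Import numFieldNormedType.Exports.

Local Open Scope classical_set_scope.
Local Open Scope ring_scope.
Local Open Scope quotient_scope.

(** The Floyd function is geometric, f(r) = eps ^ r, with eps so small that
    f(|Z_n|) is summable over time, almost surely.

    Let S_r be the sphere of radius r around e and a_r the expected number of
    visits to S_r of the walk started at v. Every vertex of S_(r+1) has a
    neighbour in S_r, so by uniform irreducibility the walk, when it stands on
    S_(r+1), is on S_r after some k < K steps with probability at least c0.
    Summing over time gives c0 * a_(r+1) <= K * a_r ([sphere_green_succ]), and
    a_0 = g(v,e) is finite by transience. If eps * K <= c0 / 2, then the sum of
    the eps ^ r * a_r, which is the expectation of the sum of the
    eps ^ |Z_n|, is at most 2 * g(v,e) ([summable_sphere_green],
    [walk_summable_ae]). Neither a bound on the degrees nor an estimate of g at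
    individual vertices is needed, and eps depends on c0 and K only.

    Almost surely all steps have length at most M, since each of them has
    positive transition probability ([walk_step_ae]). A geodesic of length at
    most M from Z_n stays at distance at least |Z_n| - M from e, so that
    d_f(Z_n, Z_(n+1)) <= M * eps ^ (- M) * eps ^ |Z_n|
    ([geometric_floyd_dist]). Hence Z_n is almost surely a Cauchy sequence for
    d_f. Its limit is not a vertex: vertices are isolated for d_f
    ([geometric_floyd_isolated]), so Z_n would eventually be constant, whereas
    eps ^ |Z_n| tends to 0 ([geometric_floyd_cvg]).

    The probabilistic input is [markov_iter], which expresses the conditional
    probability of an event n steps ahead through the n-th iterate of the
    operator c |-> P c on functions of the vertices. *)

(** * The graph distance *)

Section GraphDistanceTheory.
Context {G : lfcgraph}.
Implicit Types v w x : G.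

Lemma gdist_path v w :
  exists s, [/\ path (@adj G) v s, last v s = w & size s = gdist v w].
Proof. by rewrite /gdist; case: ex_minnP => n /asboolP. Qed.

Lemma gdist_le v s : path (@adj G) v s -> (gdist v (last v s) <= size s)%N.
Proof.
move=> vs; rewrite /gdist; case: ex_minnP => n _; apply.
by apply/asboolP; exists s.
Qed.

Lemma gdist_eq0 v w : (gdist v w == 0%N) = (v == w).
Proof.
apply/idP/eqP => [/eqP vw|<-]; last by rewrite -leqn0 (@gdist_le v [::]).
by have [[|? ?] []] := gdist_path v w; rewrite vw.
Qed.

Lemma gdist_adj e v w : adj v w -> (gdist e w <= (gdist e v).+1)%N.
Proof.
move=> vw; have [s [es sv <-]] := gdist_path e v.
have := @gdist_le e (rcons s w).
by rewrite rcons_path sv es vw last_rcons size_rcons; apply.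
Qed.

Lemma gdist_pred e w r : gdist e w = r.+1 ->
  exists2 u, adj u w & gdist e u = r.
Proof.
move=> ewr; have [s [+ + +]] := gdist_path e w.
rewrite ewr; case/lastP: s => [//|s x].
rewrite rcons_path last_rcons size_rcons.
move=> /andP[es sx] xw [sr]; rewrite xw in sx; exists (last e s) => //.
apply/eqP; rewrite eqn_leq -{1}sr gdist_le//=.
by rewrite -ltnS -ewr; exact: gdist_adj.
Qed.

Lemma countable_vertex (e : G) : countable [set: G].
Proof.
have -> : [set: G] = \bigcup_r [set w | gdist e w = r].
  by apply/seteqP; split => // w _; exists (gdist e w).
apply: bigcup_countable => // + _; elim=> [|r IHr].
  apply: (@sub_countable _ _ _ [set e]) => //.
  by apply: subset_card_le => w /= /eqP; rewrite gdist_eq0 => /eqP.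
apply: (@sub_countable _ _ _
  (\bigcup_(u in [set u | gdist e u = r]) [set w | adj u w])).
  by apply: subset_card_le => w /= /gdist_pred[u uw ur]; exists u.
apply: bigcup_countable => // u _.
exact/finite_set_countable/adj_finite.
Qed.

End GraphDistanceTheory.

(** * Sums over arbitrary and over countable index types *)

Section EsumTheory.
Context {R : realType}.
Local Open Scope ereal_scope.

Lemma esumZl (T : choiceType) (I : set T) (k : R) (a : T -> \bar R) :
  (0 <= k)%R -> (forall i, I i -> 0 <= a i) ->
  \esum_(i in I) (k%:E * a i) = k%:E * \esum_(i in I) a i.
Proof.
move=> k0 a0.
have le_esumZl (l : R) b : (0 <= l)%R -> (forall i, I i -> 0 <= b i) ->
    \esum_(i in I) (l%:E * b i) <= l%:E * \esum_(i in I) b i.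
  move=> l0 b0; apply: ge_ereal_sup => _ [X [fX XI] <-].
  rewrite fsbig_finite//= big_seq -ge0_sume_distrr; last first.
    by move=> i; rewrite in_fset_set// => /set_mem /XI/b0.
  rewrite lee_wpmul2l ?lee_fin// -big_seq; apply: ereal_sup_ubound.
  by exists X => //; rewrite fsbig_finite.
have [->|kneq0] := eqVneq k 0%R.
  by rewrite mul0e esum1// => i _; rewrite mul0e.
apply/eqP; rewrite eq_le le_esumZl//= muleC -lee_pdivlMr; last first.
  by rewrite lt_neqAle eq_sym kneq0.
have {1}-> : a = fun i => (k^-1)%:E * (k%:E * a i).
  by apply/funext => i; rewrite muleA -EFinM mulVf// mul1e.
rewrite muleC le_esumZl ?invr_ge0// => i Ii.
by rewrite mule_ge0 ?lee_fin ?a0.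
Qed.

Lemma measure_bigcup_countable d (T : measurableType d)
    (mu : {measure set T -> \bar R}) (I : choiceType) (D : set I)
    (F : I -> set T) : countable D ->
  (forall i, D i -> measurable (F i)) -> trivIset D F ->
  mu (\bigcup_(i in D) F i) = \esum_(i in D) mu (F i).
Proof.
move=> /countable_injP[phi phi_inj] mF tF.
pose F' n := \bigcup_(i in D `&` [set i | phi i = n]) F i.
have F'E i : D i -> F' (phi i) = F i.
  move=> Di; apply/seteqP; split=> [t [j [Dj /= ji] Fj]|t Fi]; last by exists i.
  by rewrite -(phi_inj j i) ?inE.
rewrite (_ : \bigcup_(i in D) F i = \bigcup_(n in phi @` D) F' n); last first.
  by rewrite bigcup_image; apply: eq_bigcupr => i Di; rewrite F'E.
rewrite measure_bigcup.
- rewrite nneseries_esum// (_ : [set x | _] = phi @` D); last first.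
    by apply/seteqP; split=> n /=; rewrite inE.
  by rewrite esum_image//; apply: eq_esum => i Di; rewrite F'E.
- by move=> _ [i Di <-]; rewrite F'E//; exact: mF.
- move=> _ _ [i Di <-] [j Dj <-]; rewrite !F'E// => /tF.
  by move=> ->.
Qed.

End EsumTheory.

(** * The transition operator and the Green function of spheres *)

Section TransitionOperator.
Context {R : realType} {G : lfcgraph} (p : G -> G -> R).
Hypothesis p_ge0 : forall v w, 0 <= p v w.
Implicit Types (c : G -> \bar R) (v w : G).
Local Open Scope ereal_scope.

(** The averaging operator c |-> P c of the transition matrix, acting on
    functions of the vertices. *)
Definition transop c v : \bar R := \esum_(u in [set: G]) ((p v u)%:E * c u).

Lemma transop_ge0 c v : (forall u, 0 <= c u) -> 0 <= transop c v.
Proof. by move=> c0; apply: esum_ge0 => u _; rewrite mule_ge0// lee_fin. Qed.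

Lemma le_transop c c' v :
  (forall u, c u <= c' u) -> transop c v <= transop c' v.
Proof. by move=> cc'; apply: le_esum => u _; rewrite lee_wpmul2l ?lee_fin. Qed.

Lemma transopZl (k : R) c v : (0 <= k)%R -> (forall u, 0 <= c u) ->
  transop (fun u => k%:E * c u) v = k%:E * transop c v.
Proof.
move=> k0 c0; rewrite -esumZl//; first by apply: eq_esum => u _; rewrite muleCA.
by move=> u _; rewrite mule_ge0// lee_fin.
Qed.

Lemma transop_sum (I : choiceType) (r : seq I) (c : I -> G -> \bar R) v :
  (forall i u, 0 <= c i u) ->
  transop (fun u => \sum_(i <- r) c i u) v = \sum_(i <- r) transop (c i) v.
Proof.
move=> c0; rewrite -esum_sum; last by move=> *; rewrite mule_ge0 ?lee_fin.
by apply: eq_esum => u _; rewrite ge0_sume_distrr.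
Qed.

Lemma iter_transop_ge0 n c v :
  (forall u, 0 <= c u) -> 0 <= iter n transop c v.
Proof. by move=> c0; elim: n v => //= n IHn v; exact: transop_ge0. Qed.

Lemma le_iter_transop n c c' v :
  (forall u, c u <= c' u) -> iter n transop c v <= iter n transop c' v.
Proof. by move=> cc'; elim: n v => //= n IHn v; exact: le_transop. Qed.

Lemma iter_transopZl n (k : R) c v : (0 <= k)%R -> (forall u, 0 <= c u) ->
  iter n transop (fun u => k%:E * c u) v = k%:E * iter n transop c v.
Proof.
move=> k0 c0; elim: n v => //= n IHn v; rewrite -transopZl//.
  by congr transop; apply/funext.
by move=> u; exact: iter_transop_ge0.
Qed.

Lemma iter_transop_sum n (I : choiceType) (r : seq I) (c : I -> G -> \bar R) v :
  (forall i u, 0 <= c i u) ->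
  iter n transop (fun u => \sum_(i <- r) c i u) v =
  \sum_(i <- r) iter n transop (c i) v.
Proof.
move=> c0; elim: n v => //= n IHn v; rewrite -transop_sum.
  by congr transop; apply/funext.
by move=> i u; exact: iter_transop_ge0.
Qed.

Lemma mxpow_iter n v w :
  mxpow p n v w = iter n transop (fun u => (u == w)%:R%:E) v.
Proof. by elim: n v => //= n IHn v; apply: eq_esum => u _; rewrite IHn. Qed.

(** Indicator function of the sphere of radius r around e. *)
Definition sphere_ind (e : G) (r : nat) (v : G) : \bar R :=
  ((gdist e v == r)%:R : R)%:E.

Lemma sphere_ind_ge0 e r v : 0 <= sphere_ind e r v.
Proof. by rewrite lee_fin. Qed.

Lemma iter_sphere_ind_ge0 n e r v : 0 <= iter n transop (sphere_ind e r) v.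
Proof. exact: iter_transop_ge0 (sphere_ind_ge0 e r). Qed.

(** The expected number of visits to the sphere of radius r around e for the
    walk started at v. *)
Definition sphere_green (e : G) (r : nat) (v : G) : \bar R :=
  \sum_(0 <= n <oo) iter n transop (sphere_ind e r) v.

Lemma sphere_green_ge0 e r v : 0 <= sphere_green e r v.
Proof.
by apply: nneseries_ge0 => n *; exact: iter_sphere_ind_ge0.
Qed.

Lemma sphere_green0 e v : sphere_green e 0 v = green p v e.
Proof.
apply: eq_eseriesr => n _; rewrite mxpow_iter; congr (iter n transop _ v).
by apply/funext => u; rewrite /sphere_ind gdist_eq0 eq_sym.
Qed.

(** A walk standing on the sphere of radius r + 1 is on the sphere of radius r
    after some k < K steps, with probability at least c0. *)
Lemma sphere_ind_succ e r v (c0 : R) (K : nat) :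
  (forall v w, adj v w ->
    exists2 k : nat, (k < K)%N & c0%:E <= mxpow p k v w) ->
  c0%:E * sphere_ind e r.+1 v <=
  \sum_(k <- iota 0 K) iter k transop (sphere_ind e r) v.
Proof.
move=> hK; rewrite {1}/sphere_ind.
have [/gdist_pred[w wv wr]|_] := eqVneq; last first.
  by rewrite mule0 sume_ge0// => k _; exact: iter_sphere_ind_ge0.
rewrite mule1; have [k kK] : exists2 k, (k < K)%N & c0%:E <= mxpow p k v w.
  by apply: hK; rewrite adj_sym.
move=> /le_trans; apply; rewrite (bigD1_seq k) ?iota_uniq ?mem_iota//=.
rewrite mxpow_iter -[leLHS]adde0 leeD//; last first.
  by rewrite sume_ge0// => l _; exact: iter_sphere_ind_ge0.
apply: le_iter_transop => u; rewrite /sphere_ind.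
by have [->|_] := eqVneq u w; rewrite ?wr ?eqxx// lee_fin.
Qed.

(** Going down one sphere: the time shifts by k < K cost a factor K. *)
Lemma sphere_green_succ e r v (c0 : R) (K : nat) : (0 < c0)%R ->
  (forall v w, adj v w ->
    exists2 k : nat, (k < K)%N & c0%:E <= mxpow p k v w) ->
  c0%:E * sphere_green e r.+1 v <= K%:R%:E * sphere_green e r v.
Proof.
move=> c00 hK; rewrite -nneseriesZl; last first.
  by move=> n _; exact: iter_sphere_ind_ge0.
have ind0 k u := iter_sphere_ind_ge0 k e r u.
apply: (@le_trans _ _ (\sum_(0 <= n <oo) \sum_(k <- iota 0 K)
    iter (n + k) transop (sphere_ind e r) v)).
  apply: lee_nneseries => n => [_ _|_].
    by rewrite mule_ge0 ?iter_sphere_ind_ge0// lee_fin ltW.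
  rewrite -iter_transopZl; [|exact: ltW|exact: sphere_ind_ge0].
  under eq_bigr do rewrite iterD.
  rewrite -(@iter_transop_sum n _ _
    (fun k => iter k transop (sphere_ind e r)))//.
  by apply: le_iter_transop => u; exact: sphere_ind_succ.
rewrite nneseries_sum//.
apply: (@le_trans _ _ (\sum_(k <- iota 0 K) sphere_green e r v)); last first.
  by rewrite big_const_seq iter_addr_0 count_predT size_iota mule_natl.
apply: lee_sum => k _; rewrite /sphere_green.
rewrite [leRHS](@nneseries_split _ _ 0 k)// add0n -(nneseries_addn k)//.
by rewrite -[leLHS]add0e leeD// sume_ge0.
Qed.

(** The weights eps ^+ r beat the growth, by a factor at most K / c0 per step,
    of the numbers of visits to the successive spheres. *)
Lemma summable_sphere_green e v (c0 eps : R) (K : nat) :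
  (0 < c0)%R -> (0 <= eps)%R -> (eps * K%:R <= c0 / 2)%R ->
  (forall v w, adj v w ->
    exists2 k : nat, (k < K)%N & c0%:E <= mxpow p k v w) ->
  green p v e < +oo ->
  \sum_(0 <= r <oo) ((eps ^+ r)%:E * sphere_green e r v) <=
  2%:E * green p v e.
Proof.
move=> c00 eps0 epsK hK goo; have a0 r := sphere_green_ge0 e r v.
have g0 : 0 <= green p v e by rewrite -sphere_green0.
have gfin : green p v e \is a fin_num by rewrite ge0_fin_numE.
have decay r :
    (eps ^+ r)%:E * sphere_green e r v <= (2^-1 ^+ r)%:E * green p v e.
  elim: r => [|r IHr]; first by rewrite !mul1e sphere_green0.
  rewrite (le_trans (y := 2^-1%:E * ((eps ^+ r)%:E * sphere_green e r v)))//.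
    rewrite -(@lee_pmul2l _ c0%:E)// muleCA.
    rewrite (le_trans (y := (eps ^+ r.+1)%:E *
      (K%:R%:E * sphere_green e r v)))//.
      by rewrite lee_wpmul2l ?lee_fin ?exprn_ge0// sphere_green_succ.
    rewrite !muleA -!EFinM lee_wpmul2r// lee_fin.
    by rewrite exprS mulrAC ler_wpM2r ?exprn_ge0.
  rewrite exprS EFinM -muleA lee_wpmul2l// lee_fin invr_ge0.
rewrite (le_trans (lee_nneseries _ (fun r _ => decay r)))//.
  by move=> r _ _; rewrite mule_ge0// lee_fin exprn_ge0.
rewrite (eq_eseriesr (fun r _ => muleC _ _)) -(fineK gfin).
rewrite nneseriesZl; last by move=> r _; rewrite lee_fin exprn_ge0.
rewrite muleC lee_wpmul2r ?fineK//.
have := @epsilon_trick0 R 2 predT (ler0n _ _).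
apply: le_trans; apply: lee_nneseries => r *; rewrite lee_fin ?exprn_ge0//.
by rewrite natrX exprS invfM mulrA divff// mul1r exprVn.
Qed.

End TransitionOperator.

(** * Markov property and null events of the random walk *)

Section MarkovProperty.
Context {R : realType} {G : lfcgraph} (p : G -> G -> R).
Hypothesis p_stoch : stochastic p.
Context {d : measure_display} {T : measurableType d} (P : probability T R).
Context (v0 : G) (Z : nat -> T -> G).
Hypothesis Zwalk : random_walk p v0 P Z.
Implicit Types (x : nat -> G) (B : nat -> set T).
Local Open Scope ereal_scope.

Let p_ge0 v w : (0 <= p v w)%R. Proof. by case: p_stoch. Qed.

Let countableG : countable [set: G] := countable_vertex v0.

Lemma measurable_walk n (A : set G) : measurable (Z n @^-1` A).
Proof.
have [mZ _ _] := Zwalk.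
have -> : Z n @^-1` A = \bigcup_(w in A) Z n @^-1` [set w].
  by apply/seteqP; split=> [t At|t [w Aw /= ->]//]; exists (Z n t).
rewrite bigcup_mkcond; apply: countable_bigcupT_measurable => // w.
by case: ifP.
Qed.

Lemma measure_walk_split n (A : set T) : measurable A ->
  P A = \esum_(w in [set: G]) P (A `&` Z n @^-1` [set w]).
Proof.
move=> mA; rewrite -measure_bigcup_countable//.
- congr (P _); apply/seteqP; split=> [t At|t [w _ []]//].
  by exists (Z n t).
- by move=> w _; apply: measurableI => //; exact: measurable_walk.
- by move=> w w' _ _ [t [[_ /= <-] [_ <-]]].
Qed.

(** The event that the walk follows the path x up to time m. *)
Definition follows x m : set T := [set t | forall i, (i <= m)%N -> Z i t = x i].

Lemma measurable_follows x m : measurable (follows x m).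
Proof.
have -> : follows x m = \bigcap_(i in `I_m.+1) Z i @^-1` [set x i].
  by apply/seteqP; split=> t xt i; exact: xt.
by apply: bigcap_measurable => [|i _]; [exists 0%N|exact: measurable_walk].
Qed.

(** If the event B k has conditional probability c(Z_k) given the past up to
    time k, then B (m + n) has conditional probability (P^n c)(Z_m) given the
    past up to time m. *)
Lemma markov_iter B (c : G -> \bar R) :
  (forall k, measurable (B k)) -> (forall w, 0 <= c w) ->
  (forall x m, P (follows x m `&` B m) = P (follows x m) * c (x m)) ->
  forall n x m, P (follows x m `&` B (m + n)%N) =
                P (follows x m) * iter n (transop p) c (x m).
Proof.
move=> mB c0 hB; elim=> [|n IHn] x m; first by rewrite addn0.
have mxm := measurable_follows x m.
(* Condition on the position at time m + 1. *)
rewrite (@measure_walk_split m.+1); last exact: measurableI.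
(* The path x up to time m, continued by a step to w. *)
pose upd w i := if i == m.+1 then w else x i.
have updE w : follows (upd w) m = follows x m.
  apply/seteqP; split=> t xt i im; have := xt i im; rewrite /upd;
  by rewrite ltn_eqF.
have updS w : follows (upd w) m.+1 = follows x m `&` Z m.+1 @^-1` [set w].
  apply/seteqP; split=> [t xt|t [xt /= xw] i].
    split => /=; last by rewrite xt// /upd eqxx.
    by rewrite -(updE w) => i im; apply: xt; exact: leqW.
  by rewrite leq_eqVlt ltnS /upd; case: eqVneq => [->//|_ /=]; exact: xt.
have [_ _ Zstep] := Zwalk.
under eq_esum => w _.
  rewrite setIAC -updS addnS -addSn IHn Zstep -/(follows (upd w) m) updE.
  rewrite /upd eqxx (ltn_eqF (ltnSn m)) -muleA.
  over.
rewrite -[P _]fineK ?fin_num_measure// esumZl ?fine_ge0//.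
by move=> w _; rewrite mule_ge0 ?lee_fin ?iter_transop_ge0.
Qed.

(** The start Z_0 = v0 is an almost sure event. *)
Lemma measure_start (A : set T) : measurable A ->
  P A = P (follows (fun=> v0) 0 `&` A).
Proof.
move=> mA; have [mZ Z0 _] := Zwalk; have mf := measurable_follows (fun=> v0) 0.
have f1 : P (follows (fun=> v0) 0) = 1.
  rewrite -Z0; congr (P _); apply/seteqP; split=> t; first exact.
  by move=> /= tv0 i; rewrite leqn0 => /eqP ->.
rewrite (measureDI _ mA mf) setIC.
rewrite [X in X + _](_ : _ = 0) ?add0e//.
apply/eqP; rewrite eq_le measure_ge0 andbT.
rewrite (@le_trans _ _ (P (~` follows (fun=> v0) 0)))//.
  by apply: le_measure; rewrite ?inE; [exact: measurableD|exact: measurableC|].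
by rewrite probability_setC// f1 subee.
Qed.

Lemma walk_sphere e r n :
  P (Z n @^-1` [set w | gdist e w = r]) =
  iter n (transop p) (sphere_ind e r) v0.
Proof.
pose B n := Z n @^-1` [set w | gdist e w = r].
rewrite measure_start; last exact: measurable_walk.
have := @markov_iter B (sphere_ind e r) _ _ _ n (fun=> v0) 0%N.
rewrite add0n => -> //.
- rewrite -[X in X * _ = _](_ : 1 = _) ?mul1e//; have [_ <- _] := Zwalk.
  rewrite measure_start; last exact: measurable_walk.
  congr (P _); apply/seteqP; split => [t []//|t tv0]; split => //=.
  exact: tv0.
- by move=> k; exact: measurable_walk.
- exact: sphere_ind_ge0.
- move=> x m; rewrite /sphere_ind; have [xr|/eqP xr] := eqVneq.
    rewrite mule1; congr (P _); apply/seteqP; split => [t []//|t xt].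
    by split => //; rewrite /B /= xt.
  rewrite mule0 (_ : _ `&` _ = set0) ?measure0//.
  by apply/seteqP; split => // t [xt]; rewrite /B /= xt.
Qed.

(** Apply [markov_iter] with c = 0 to the events p(Z_k, Z_(k+1)) = 0. *)
Lemma walk_step_ae : {ae P, forall t n, (0 < p (Z n t) (Z n.+1 t))%R}.
Proof.
apply: ae_foralln => n.
pose B n := [set t | p (Z n t) (Z n.+1 t) = 0%R].
have mB k : measurable (B k).
  have -> : B k = \bigcup_(w in [set: G])
      (Z k @^-1` [set w] `&` Z k.+1 @^-1` [set u | p w u = 0%R]).
    apply/seteqP; split=> [t Bt|t [w _ [/= <-]]//].
    by exists (Z k t).
  apply: countable_bigcupT_measurable => // w.
  by apply: measurableI; exact: measurable_walk.
have PB0 : P (B n) = 0.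
  rewrite measure_start//.
  have := @markov_iter B (fun=> 0) mB _ _ n (fun=> v0) 0%N.
  rewrite add0n => -> //.
    suff -> : iter n (transop p) (fun=> 0) = fun=> 0 by rewrite mule0.
    elim: n => //= n ->; apply/funext => w; rewrite /transop esum1// => u _.
    exact: mule0.
  move=> x m; rewrite mule0 (measure_walk_split m.+1); last first.
    by apply: measurableI => //; exact: measurable_follows.
  have [_ _ Zstep] := Zwalk; apply: esum1 => w _.
  pose y i := if i == m.+1 then w else x i.
  have [pw|pw] := eqVneq (p (x m) w) 0%R; last first.
    rewrite (_ : _ `&` _ = set0) ?measure0//; apply/seteqP; split => // t.
    move=> [[xt Bt] /= tw]; move: Bt pw.
    by rewrite /B/= tw xt// => ->; rewrite eqxx.
  apply/eqP; rewrite eq_le measure_ge0 andbT.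
  apply: (@le_trans _ _ (P (follows y m.+1))).
    apply: le_measure; rewrite ?inE.
    - apply: measurableI; last exact: measurable_walk.
      by apply: measurableI => //; exact: measurable_follows.
    - exact: measurable_follows.
    - move=> t [[xt _] /= tw] i; rewrite leq_eqVlt ltnS /y.
      by case: eqVneq => [->//|_ /=]; exact: xt.
  by rewrite Zstep /y eqxx (ltn_eqF (ltnSn m)) pw mule0.
exists (B n); split => // t /= /negP.
by rewrite lt_neqAle p_ge0 andbT negbK => /eqP.
Qed.

End MarkovProperty.

(** * Expected Floyd weight of the trajectory *)

Section SummableTrajectory.
Context {R : realType} {G : lfcgraph} (p : G -> G -> R).
Hypothesis p_stoch : stochastic p.
Context {d : measure_display} {T : measurableType d} (P : probability T R).
Context (v0 : G) (Z : nat -> T -> G).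
Hypothesis Zwalk : random_walk p v0 P Z.
Local Open Scope ereal_scope.

(** The finite sum in the hypothesis is the expectation of the series. *)
Lemma walk_summable_ae (e : G) (eps : R) : (0 <= eps)%R ->
  \sum_(0 <= r <oo) ((eps ^+ r)%:E * sphere_green p e r v0) < +oo ->
  {ae P, forall t, cvgn (series (fun n => eps ^+ gdist e (Z n t))%R)}.
Proof.
move=> eps0 Soo; have p_ge0 v w : (0 <= p v w)%R by case: p_stoch.
have epsX r : (0 <= eps ^+ r)%R by exact: exprn_ge0.
(* eps ^+ |Z_n| is written as a sum over r of multiples of the indicators of
   the events |Z_n| = r, so that the expectation can be taken termwise. *)
pose S n r := Z n @^-1` [set w | gdist e w = r].
have mS n r : measurable (S n r) := measurable_walk Zwalk n _.
pose h n r t : \bar R := (eps ^+ r)%:E * (\1_(S n r) t)%:E.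
have h0 n r t : 0 <= h n r t by rewrite mule_ge0// lee_fin.
have mh n r : measurable_fun [set: T] (h n r).
  apply: measurable_funeM; apply/measurable_EFinP.
  exact: measurable_indic.
have hE n t : \sum_(r <oo) h n r t = (eps ^+ gdist e (Z n t))%:E.
  rewrite (@nneseriesD1 _ _ (gdist e (Z n t)))// eseries0.
    by rewrite adde0 /h indicE mem_set// mule1.
  move=> r _ /= rZ; rewrite /h indicE memNset ?mule0// => /= Zr.
  by rewrite -Zr eqxx in rZ.
pose H t := \sum_(n <oo) \sum_(r <oo) h n r t.
have mH n : measurable_fun [set: T] (fun t => \sum_(r <oo) h n r t).
  exact: ge0_emeasurable_sum.
have H0 n t : 0 <= \sum_(r <oo) h n r t by exact: nneseries_ge0.
have intH : \int[P]_t H t < +oo.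
  rewrite integral_nneseries//.
  rewrite (_ : \sum_(n <oo) _ = \sum_(n <oo) \sum_(r <oo)
      ((eps ^+ r)%:E * iter n (transop p) (sphere_ind e r) v0)).
    rewrite nneseries_interchange//; last first.
      by move=> n r; rewrite mule_ge0 ?lee_fin ?iter_sphere_ind_ge0.
    move: Soo; congr (_ < _); apply: eq_eseriesr => r _.
    by rewrite -nneseriesZl// => n _; exact: iter_sphere_ind_ge0.
  apply: eq_eseriesr => n _; rewrite integral_nneseries//.
  apply: eq_eseriesr => r _; rewrite ge0_integralZl_EFin//.
    rewrite integral_indic// setIT; congr (_ * _).
    exact: (walk_sphere p_stoch Zwalk).
  by apply/measurable_EFinP; exact: measurable_indic.
have iH : P.-integrable setT H.
  apply/integrableP; split; first exact: ge0_emeasurable_sum.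
  by under eq_integral => t _ do rewrite gee0_abs ?nneseries_ge0//.
have := integrable_ae measurableT iH.
apply: filterS => t /(_ Logic.I); rewrite ge0_fin_numE ?nneseries_ge0// => Ht.
apply: nnseries_is_cvg => //.
by under eq_eseriesr do rewrite -hE.
Qed.

End SummableTrajectory.

(** * Geometric Floyd functions *)

(** A sequence whose consecutive distances have a convergent sum is Cauchy. *)
Lemma cauchy_mdist_series (R : realType) (T : metricType R) (x : nat -> T)
    (u : nat -> R) : (forall n, mdist (x n) (x n.+1) <= u n) ->
  cvgn (series u) -> cauchy (x @ \oo).
Proof.
move=> xu /cvg_ex[/= l /cvgrPdist_lt su]; apply: lt_cauchy_seq => eps eps0.
have [N _ hN] := su _ (divr_gt0 eps0 (ltr0Sn _ 1)).
exists N => m n; wlog mn : m n / (m <= n)%N => [h|] Nm Nn.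
  by have [/h|/ltnW/h] := leqP m n; [exact|rewrite metric_sym; exact].
rewrite (le_lt_trans (y := series u n - series u m))//.
  rewrite -(subnKC mn); elim: (n - m)%N => [|k IHk].
    by rewrite addn0 mdistxx subrr.
  rewrite addnS seriesS (le_trans (metric_triangle _ (x (m + k)%N) _))//.
  by rewrite addrC -addrA lerD.
move: (hN _ Nm) (hN _ Nn); rewrite /= !ltr_norml.
by set a := series u n; set b := series u m; lra.
Qed.

Lemma geometric_is_floyd (R : realType) (eps : R) : 0 < eps < 1 ->
  is_floyd_function (fun r => eps ^+ r).
Proof.
move=> /andP[eps0 eps1]; split.
- by move=> r; exact: exprn_gt0.
- by exists eps => // r _; rewrite -exprS lexx/= exprS ler_piMl ?exprn_ge0 ?ltW.
- have := @is_cvg_geometric_series R 1 eps; rewrite gtr0_norm// => /(_ eps1).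
  rewrite (_ : geometric _ _ = fun r => eps ^+ r)//.
  by apply/funext => r /=; rewrite mul1r.
Qed.

Section GeometricFloyd.
Context {R : realType} {G : lfcgraph} (e : G) (f : floydFunction R) (eps : R).
Hypothesis eps01 : 0 < eps < 1.
Hypothesis fE : forall r, f r = eps ^+ r.
Implicit Types v w : G.

Let eps_gt0 : 0 < eps. Proof. by case/andP: eps01. Qed.
Let eps_le1 : eps <= 1. Proof. by case/andP: eps01 => _ /ltW. Qed.

Let expr_le m n : (m <= n)%N -> eps ^+ n <= eps ^+ m.
Proof. by move=> mn; rewrite ler_wiXn2l// ltW. Qed.

(** The vertices of a path of length k issued from v stay at distance at least
    |v| - k from e; multiplying by eps ^+ k avoids the subtraction. *)
Lemma geometric_floyd_length v s : path (@adj G) v s ->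
  eps ^+ size s * floyd_length e f v s <= (size s)%:R * eps ^+ gdist e v.
Proof.
elim: s v => [|x s IHs] v /=.
  by rewrite /floyd_length big_nil mulr0 mul0r.
move=> /andP[vx xs]; rewrite /floyd_length/= big_cons -/(floyd_length e f x s).
have vx1 : (gdist e v <= (gdist e x).+1)%N by apply: gdist_adj; rewrite adj_sym.
rewrite mulrDr -natr1 mulrDl mul1r addrC lerD//.
  rewrite exprS -mulrA; apply: le_trans (ler_wpM2l (ltW eps_gt0) (IHs _ xs)) _.
  by rewrite mulrCA ler_wpM2l// -exprS expr_le.
rewrite fE -exprD expr_le// addSn -addnS (leq_trans _ (leq_addl _ _))//.
by rewrite /edge_norm -minnSS leq_min leqnSn.
Qed.

Lemma geometric_floyd_dist v w (M : nat) : (gdist v w <= M)%N ->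
  eps ^+ M * floyd_dist e f v w <= M%:R * eps ^+ gdist e v.
Proof.
have [s [vs sw <-]] := gdist_path v w; move=> sM.
have epsX n : 0 <= eps ^+ n by exact/exprn_ge0/ltW.
rewrite (le_trans (y := eps ^+ size s * floyd_length e f v s))//.
  rewrite ler_pM ?floyd_dist_ge0 ?expr_le//.
  by rewrite -sw floyd_dist_le.
rewrite (le_trans (geometric_floyd_length vs))//.
by rewrite ler_wpM2r// ler_nat.
Qed.

(** Vertices are isolated points for the Floyd distance. *)
Lemma geometric_floyd_isolated v w : v != w ->
  eps ^+ gdist e v <= floyd_dist e f v w.
Proof.
move=> vw; apply: le_floyd_dist => -[_ /= wv|x s _ _].
  by rewrite wv eqxx in vw.
rewrite /floyd_length/= big_cons fE.
rewrite (le_trans (expr_le (geq_minl _ (gdist e x))))//.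
by rewrite lerDl; exact: floyd_length_ge0.
Qed.

(** A sequence of vertices with bounded steps and summable Floyd weights
    converges to a boundary point. *)
Lemma geometric_floyd_cvg (z : nat -> G) (M : nat) :
  (forall n, (gdist (z n) (z n.+1) <= M)%N) ->
  cvgn (series (fun n => eps ^+ gdist e (z n))) ->
  exists2 xi : floyd_compactification e f,
    floyd_boundary e f xi & (fun n => floyd_embed e f (z n)) @ \oo --> xi.
Proof.
move=> zM zcvg.
have epsM : 0 < eps ^+ M by exact: exprn_gt0.
pose C := M%:R / eps ^+ M.
have zC n : floyd_dist e f (z n) (z n.+1) <= C * eps ^+ gdist e (z n).
  by rewrite mulrAC ler_pdivlMr// mulrC geometric_floyd_dist.
pose FS : metricType R :=
  Defs_floyd_space__canonical__metric_structure_Metric e f.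
have cz : cauchy ((z : nat -> FS) @ \oo).
  apply: (@cauchy_mdist_series _ FS z
    (fun n => C * eps ^+ gdist e (z n))) => //.
  rewrite -[X in series X]/(C *: (fun n => eps ^+ gdist e (z n))).
  exact: is_cvg_seriesZ.
have zxi := @cvg_to_completion _ FS (CauchySeq cz).
exists (\pi_(completion FS) (CauchySeq cz)) => //.
(* If the limit were a vertex w, then z n = w and eps ^+ |z n| < eps ^+ |w|
   for some large n. *)
move=> [w _ wxi].
have /metricType_numDomainType.cvgrPdist_lt zw := zxi.
have [N1 _ h1] := zw _ (exprn_gt0 (gdist e w) eps_gt0).
have /cvgrPdist_lt h0 := cvg_series_cvg_0 zcvg.
have [N2 _ h2] := h0 _ (exprn_gt0 (gdist e w) eps_gt0).
pose n := maxn N1 N2.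
have := h1 n (leq_maxl _ _); rewrite -wxi /= mdist_to_completion => wz.
have zwE : w = z n.
  apply/eqP; apply: contraTT wz => /geometric_floyd_isolated.
  by rewrite -leNgt.
have := h2 n (leq_maxr _ _); rewrite /= -zwE sub0r normrN.
by rewrite ger0_norm ?ltxx// ltW// exprn_gt0.
Qed.

End GeometricFloyd.

(** * Convergence to the Floyd boundary *)

Theorem theorem2p2 (R : realType) (G : lfcgraph) (e : G) (p : G -> G -> R) :
  stochastic p -> transient p -> uniformly_irreducible p -> bounded_range p ->
  exists f : floydFunction R,
    forall (v : G) (d : measure_display) (T : measurableType d)
      (P : probability T R) (Z : nat -> T -> G),
      random_walk p v P Z ->
      {ae P, forall t, exists2 xi : floyd_compactification e f,
        floyd_boundary e f xi &
        (fun n => floyd_embed e f (Z n t)) @ \oo --> xi}.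
Proof.
move=> p_stoch p_trans [c0 [K [c00 K0 hK]]] [M M0 pM].
have p_ge0 v w : (0 <= p v w)%R by case: p_stoch.
(* eps <= 1/2 makes f summable, eps <= c0 / (2 K) beats the factor K / c0. *)
pose eps : R := Num.min 2^-1 (c0 / (2 * K%:R)).
have KR0 : 0 < K%:R :> R by rewrite ltr0n.
have eps01 : 0 < eps < 1.
  rewrite lt_min gt_min invr_gt0 ltr0Sn divr_gt0 ?mulr_gt0//=.
  by rewrite invf_lt1// ltr1n.
have epsK : eps * K%:R <= c0 / 2.
  rewrite -ler_pdivlMr// -mulrA -invfM ge_min.
  by rewrite lexx orbT.
exists (FloydFunction (geometric_is_floyd eps01)) => v d T P Z Zwalk.
have eps0 : 0 <= eps by case/andP: eps01 => /ltW.
have Soo : (\sum_(0 <= r <oo) ((eps ^+ r)%:E * sphere_green p e r v) < +oo)%E.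
  apply: le_lt_trans (summable_sphere_green p_ge0 c00 eps0 epsK hK _) _ => //.
  exact: lte_mul_pinfty.
have Zsum := walk_summable_ae p_stoch Zwalk eps0 Soo.
have Zstep := walk_step_ae p_stoch Zwalk.
apply: filterS2 Zsum Zstep => t Zsum Zstep.
apply: (@geometric_floyd_cvg R G e _ eps _ _ (Z ^~ t) M) => //.
by move=> n; exact: pM.
Qed.
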